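(* The following assertions are equivalent. (1) $\mathfrak b=\omega_1$. (2) There is a system of fundamental sequences $\Lambda$ such that the family $(s^\Lambda_\alpha)_{\alpha<\omega_1}$ is $\leqslant^*$-unbounded in $(\mathbb N^\star)^{\mathbb N^\star}$. (3) There is a system of fundamental sequences $\Lambda$ such that, for every infinite compact interval family $\mathcal K\subseteq \mathrm{FIN}^\star$, there is $\alpha<\omega_1$ for which $\mathcal K\cap\mathcal S^\Lambda_\alpha$ is infinite. (4) There is a system of fundamental sequences $\Lambda$ such that, for every uncountable $A\subseteq\omega_1$, there is $n\in\mathbb N^\star$ with $$[\{n,n+1,\ldots\}]^{<\omega}\subseteq\bigcup_{\alpha\in A}\mathcal S^\Lambda_\alpha .$$
   Context: Let $\mathbb N^\star=\{2,3,\ldots\}$. For a set $X$, $[X]^{<\omega}$ is the set of all finite subsets of $X$, and $\mathrm{FIN}^\star=[\mathbb N^\star]^{<\omega}$. Sets in $\mathrm{FIN}^\star$ are identified with their characteristic functions in the compact product space $2^{\mathbb N^\star}$; compactness of a subfamily of $\mathrm{FIN}^\star$ refers to the topology inherited from $2^{\mathbb N^\star}$. For non-empty $E,F\in\mathrm{FIN}^\star$, $E<F$ means $\max E<\min F$; for $d\in\mathbb N^\star$ and non-empty $A\in \mathrm{FIN}^\star$, $d\leqslant A$ means $d\leqslant\min A$. Let $\mathrm{Lim}(\omega_1)$ be the set of countable (non-zero) limit ordinals. A system of fundamental sequences is a family $\Lambda=(\lambda[n])_{\lambda\in\mathrm{Lim}(\omega_1),\,n\in\mathbb N^\star}$ of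 ordinals such that, for every $\lambda\in\mathrm{Lim}(\omega_1)$, $\lambda[2]<\lambda[3]<\cdots<\lambda=\sup_{n\in\mathbb N^\star}\lambda[n]$. Given $\Lambda$, the families $(\mathcal S^\Lambda_\alpha)_{\alpha<\omega_1}$ are defined recursively by $\mathcal S^\Lambda_0=\{\emptyset\}\cup\{\{n\}: n\in\mathbb N^\star\}$; $\mathcal S^\Lambda_{\alpha+1}=\mathcal S^\Lambda_\alpha\cup\{\bigcup_{i=1}^d A_i : 2\leqslant d\leqslant A_1<\cdots<A_d \text{ and } A_i\in\mathcal S^\Lambda_\alpha\setminus\{\emptyset\} \text{ for all } i\}$; and, for $\lambda\in\mathrm{Lim}(\omega_1)$, $\mathcal S^\Lambda_\lambda=\{\emptyset\}\cup\{A\in\mathrm{FIN}^\star\setminus\{\emptyset\} : \exists d\in\mathbb N^\star\ (d\leqslant A \text{ and } A\in\mathcal S^\Lambda_{\lambda[d]})\}$. For $n\leqslant k$ in $\mathbb N^\star$, $[n,k]=\{n,n+1,\ldots,k\}$; such sets are called intervals. An interval family is a family $\mathcal K\subseteq\mathrm{FIN}^\star$ whose non-empty members are intervals. For $\alpha<\omega_1$ and $n\in\mathbb N^\star$, $s^\Lambda_\alpha(n)=\max\{k\in\mathbb N^\star : n\leqslant k \text{ and } [n,k]\in\mathcal S^\Lambda_\alpha\}$ (this maximum exists). For $g,h:\mathbb N^\star\to\mathbb N^\star$, $g\leqslant^*h$ means $g(n)\leqslant h(n)$ for all but finitely many $n$. A family is $\leqslant^*$-unbounded if no single $h\in(\mathbb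 N^\star)^{\mathbb N^\star}$ satisfies $f\leqslant^* h$ for all its members $f$. The bounding number $\mathfrak b$ is the least cardinality of a $\leqslant^*$-unbounded family in $(\mathbb N^\star)^{\mathbb N^\star}$. *)

(* Defs.v *)
From HB Require Import structures.
From mathcomp Require Import all_boot all_order.
From mathcomp Require Import boolp contra wochoice classical_sets functions.
From mathcomp Require Import cardinality topology.

Set Implicit Arguments.
Unset Strict Implicit.
Unset Printing Implicit Defensive.

Import Order.TTheory.

Local Open Scope classical_set_scope.
Local Open Scope card_scope.

(* The ordinal omega_1, realized as a well-ordered type: fix a well-ordering  *)
(* of the uncountable type [set nat] and keep the points having only          *)
(* countably many predecessors.                                               *)

Definition wo_le : rel (set nat) := sval (well_ordering_principle (set nat)).

Lemma wo_le_well_order : well_order wo_le.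
Proof. exact: svalP. Qed.

Lemma wo_le_min (A : set (set nat)) : A !=set0 ->
  exists2 z, A z & forall x, A x -> wo_le z x.
Proof.
move=> [x Ax]; have [|z [[zA zmin] _]] := @wo_le_well_order (mem A).
  by exists x; apply/mem_set.
by exists z; [exact/set_mem | move=> y /mem_set/zmin].
Qed.

Lemma wo_le_total : total wo_le.
Proof.
move=> x y; have [|z zxy zmin] := @wo_le_min [set x; y]; first by exists x; left.
by case: zxy => zE; rewrite {}zE in zmin; apply/orP; [left|right]; apply: zmin; [right|left].
Qed.

Lemma wo_le_anti : antisymmetric wo_le.
Proof.
move=> x y xy; apply: (@wo_chain_antisymmetric _ wo_le predT) xy => //.
by move=> A _; exact: wo_le_well_order.
Qed.

Lemma wo_le_trans : transitive wo_le.
Proof.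
move=> y x z xy yz.
have [|t txyz tmin] := @wo_le_min [set x; y; z]; first by exists x; left; left.
have tx : wo_le t x by apply: tmin; left; left.
have ty : wo_le t y by apply: tmin; left; right.
have tz : wo_le t z by apply: tmin; right.
case: txyz => [[]|] tE; rewrite {}tE in tx ty tz => //.
- by rewrite (@wo_le_anti x y) // xy tx.
- by rewrite -(@wo_le_anti y z) // yz ty.
Qed.

Definition countable_below : pred (set nat) :=
  fun x => `[< countable [set y | wo_le y x && (y != x)] >].

Record omega1 : Type := Omega1 {
  omega1_val : set nat;
  omega1_valP : countable_below omega1_val
}.

HB.instance Definition _ := [isSub for omega1_val].
HB.instance Definition _ := [Choice of omega1 by <:].

Fact omega1_display : Order.disp_t. Proof. exact: Order.Disp tt tt. Qed.

Section Omega1Order.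

Let le (a b : omega1) := wo_le (val a) (val b).
Let lt (a b : omega1) := (b != a) && le a b.

Let le_anti : antisymmetric le.
Proof. by move=> a b /wo_le_anti/val_inj. Qed.

Let le_trans : transitive le.
Proof. by move=> b a c; exact: wo_le_trans. Qed.

Let le_total : total le.
Proof. by move=> a b; exact: wo_le_total. Qed.

HB.instance Definition _ := Order.isOrder.Build omega1_display omega1
  (fun _ _ => erefl : lt _ _ = _) (fun _ _ => erefl) (fun _ _ => erefl)
  le_anti le_trans le_total.

End Omega1Order.

Lemma omega1_leE (a b : omega1) : (a <= b)%O = wo_le (val a) (val b).
Proof. by []. Qed.

Lemma omega1_min (A : set omega1) : A !=set0 ->
  exists2 a, A a & forall b, A b -> (a <= b)%O.
Proof.
move=> [a Aa]; have [|_ [b Ab <-] bmin] := @wo_le_min [set val b | b in A].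
  by exists (val a), a.
by exists b => // c Ac; rewrite omega1_leE bmin //; exists c.
Qed.

Lemma omega1_ind (P : omega1 -> Prop) :
  (forall a, (forall b, (b < a)%O -> P b) -> P a) -> forall a, P a.
Proof.
move=> IH a; apply: contrapT => nPa.
have [|b nPb bmin] := @omega1_min [set b | ~ P b]; first by exists a.
apply/nPb/IH => c cb; apply: contrapT => /bmin; by rewrite leNgt cb.
Qed.

Lemma omega1_countable_below (a : omega1) :
  countable [set b : omega1 | (b < a)%O].
Proof.
have /asboolP := omega1_valP a.
move=> /countable_injP[f finj]; apply/countable_injP; exists (f \o val).
move=> b c; rewrite !inE /= => /andP[ba lba] /andP[ca lca] fbc; apply: val_inj.
by apply: finj fbc; apply/mem_set => /=; apply/andP; split => //;
  rewrite (inj_eq val_inj) eq_sym.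
Qed.

Lemma omega1_uncountable : ~ countable [set: omega1].
Proof.
move=> cO.
have [[x nx]|allx] := pselect (exists x, ~ countable_below x).
  have [|y ny ymin] := @wo_le_min [set x | ~ countable_below x]; first by exists x.
  apply: ny; apply/asboolP; apply: sub_countable cO.
  apply: card_le_trans (card_image_le val _); apply: subset_card_le.
  move=> z /= /andP[zy zNy]; have cz : countable_below z.
    apply: contrapT => /ymin yz; move: zNy.
    by rewrite (@wo_le_anti z y) ?eqxx // zy yz.
  by exists (Omega1 cz).
have cT : countable [set: set nat].
  apply: sub_countable cO; apply: card_le_trans (card_image_le val _).
  apply: subset_card_le => z _.
  have cz : countable_below z by apply: contrapT => ?; apply: allx; exists z.
  by exists (Omega1 cz).
have /countable_injP[f finj] := cT.
pose D := [set n | exists2 A : set nat, n = f A & ~ A n].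
have [Df|nDf] := pselect (D (f D)).
  have [A fDA nA] := Df; apply: nA.
  by rewrite -(finj D A) ?inE.
by apply/nDf; exists D.
Qed.

Definition is_zero (a : omega1) : Prop := forall b, (a <= b)%O.

Definition is_succ (a b : omega1) : Prop :=
  (a < b)%O /\ forall c, (a < c)%O -> (b <= c)%O.

Definition is_limit (l : omega1) : Prop :=
  ~ is_zero l /\ forall a, ~ is_succ a l.

Lemma omega1_zero_ex : exists a, is_zero a.
Proof.
have [|a _ amin] := @omega1_min setT; last by exists a => b; exact: amin.
by apply: contrapT => n0; apply: omega1_uncountable; apply/countable_injP;
  exists (fun=> 0) => a; exfalso; apply: n0; exists a.
Qed.

Lemma omega1_succ_ex a : exists b, is_succ a b.
Proof.
have [|b ab bmin] := @omega1_min [set b | (a < b)%O]; last by exists b.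
apply: contrapT => n0; apply: omega1_uncountable.
have /countable_injP[f finj] := omega1_countable_below a.
apply/countable_injP; exists (fun b => if b == a then 0 else (f b).+1).
have lta b : b != a -> b \in [set b : omega1 | (b < a)%O].
  move=> ba; apply/mem_set; case: (ltgtP b a) ba => // ab _.
  by exfalso; apply: n0; exists b.
move=> b c _ _; case: eqVneq => [->|/lta ba]; case: eqVneq => [->|/lta ca] //.
by case=> /finj; apply.
Qed.

Lemma is_zero_inj a b : is_zero a -> is_zero b -> a = b.
Proof. by move=> a0 b0; apply/le_anti; rewrite a0 b0. Qed.

Lemma is_succ_inj a b c : is_succ a c -> is_succ b c -> a = b.
Proof.
move=> [ac acmin] [bc bcmin]; case: (ltgtP a b) => // [/acmin|/bcmin].
  by rewrite leNgt bc.
by rewrite leNgt ac.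
Qed.

Lemma is_succ_not_zero a b : is_succ a b -> ~ is_zero b.
Proof. by move=> [ab _] /(_ a); rewrite leNgt ab. Qed.

Record nstar : Type := NStar { nstar_val :> nat; nstar_valP : 2 <= nstar_val }.

HB.instance Definition _ := [isSub for nstar_val].
HB.instance Definition _ := [Countable of nstar by <:].

Definition FINstar : set (set nstar) := [set E | finite_set E].

(* For non-empty finite sets: max E < min F. *)
Definition set_before (E F : set nstar) : Prop :=
  forall x y : nstar, E x -> F y -> x < y.

(* For a non-empty set: d <= min E. *)
Definition le_set (d : nstar) (E : set nstar) : Prop :=
  forall x : nstar, E x -> d <= x.

(* The values of [L] at non-limit ordinals are irrelevant. *)
Definition fundamental_system (L : omega1 -> nstar -> omega1) : Prop :=
  forall l, is_limit l ->
    [/\ forall m n : nstar, m < n -> (L l m < L l n)%O,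
        forall n, (L l n < l)%O
      & supremums (range (L l)) l].

(* [schreier L a] is S_a^L.  As every a is exactly one of zero, successor or  *)
(* limit, the clauses amount to a definition by transfinite recursion: see    *)
(* schreier_zeroE, schreier_succE and schreier_limitE.  The blocks A_1, ...,  *)
(* A_d are indexed from 0.                                                    *)
Inductive schreier (L : omega1 -> nstar -> omega1) :
    omega1 -> set (set nstar) :=
| schreier_zero_empty a : is_zero a -> schreier L a set0
| schreier_zero_single a n : is_zero a -> schreier L a [set n]
| schreier_succ_incl a b E : is_succ a b -> schreier L a E -> schreier L b E
| schreier_succ_union a b (d : nstar) (B : nat -> set nstar) : is_succ a b ->
    (forall i, i < d -> schreier L a (B i)) ->
    (forall i, i < d -> B i !=set0) ->
    le_set d (B 0) ->
    (forall i, i.+1 < d -> set_before (B i) (B i.+1)) ->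
    schreier L b (\bigcup_(i < d) B i)
| schreier_limit_empty l : is_limit l -> schreier L l set0
| schreier_limit_mem l (d : nstar) E : is_limit l ->
    FINstar E -> E !=set0 -> le_set d E -> schreier L (L l d) E ->
    schreier L l E.

Lemma schreier_zeroE L a : is_zero a ->
  schreier L a = [set set0] `|` range (@set1 nstar).
Proof.
move=> a0; apply/seteqP; split=> E.
- move=> SE; move: a0.
  case: a E / SE => [a _|a n _|a b E ab _|a b d B ab _ _ _ _|l lim|
    l d E lim _ _ _ _] a0.
  + by left.
  + by right; exists n.
  + by case: (is_succ_not_zero ab).
  + by case: (is_succ_not_zero ab).
  + by case: lim.
  + by case: lim.
- by case=> [->|[n _ <-]]; [exact: schreier_zero_empty |
    exact: schreier_zero_single].
Qed.

Lemma schreier_succE L a b : is_succ a b ->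
  schreier L b = schreier L a `|`
    [set E | exists (d : nstar) (B : nat -> set nstar),
      [/\ E = \bigcup_(i < d) B i,
          le_set d (B 0),
          forall i, i.+1 < d -> set_before (B i) (B i.+1)
        & forall i, i < d -> schreier L a (B i) /\ B i <> set0]].
Proof.
move=> ab; apply/seteqP; split=> E.
- move=> SE; move: ab.
  case: b E / SE => [b z|b n z|a' b E ab' SE|a' b d B ab' SB B0 dB ltB|b lim|
    b d E lim _ _ _ _] ab.
  + by case: (is_succ_not_zero ab).
  + by case: (is_succ_not_zero ab).
  + by left; rewrite (is_succ_inj ab ab').
  + right; exists d, B; split=> // i id.
    by rewrite (is_succ_inj ab ab'); split; [exact: SB | exact/eqP/set0P/B0].
  + by case: lim => _ /(_ a).
  + by case: lim => _ /(_ a).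
- case=> [SE|[d [B [-> dB ltB SB]]]]; first exact: schreier_succ_incl SE.
  apply: schreier_succ_union ab _ _ dB ltB => i /SB[] // _ /eqP.
  by move=> /set0P.
Qed.

Lemma schreier_limitE L l : is_limit l ->
  schreier L l = [set set0] `|`
    [set E | [/\ FINstar E, E <> set0
      & exists d : nstar, le_set d E /\ schreier L (L l d) E]].
Proof.
move=> lim; apply/seteqP; split=> E.
- move=> SE; move: lim.
  case: l E / SE => [l z|l n z|a l E al SE|a l d B al SB B0 dB ltB|l _|
    l d E _ FE E0 dE SE] lim.
  + by left.
  + by case: lim.
  + by case: lim => _ /(_ a).
  + by case: lim => _ /(_ a).
  + by left.
  + by right; split=> //; [exact/eqP/set0P | exists d].
- case=> [->|[FE /eqP/set0P E0 [d [dE SE]]]]; first exact: schreier_limit_empty.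
  exact: schreier_limit_mem SE.
Qed.

Definition interval (n k : nstar) : set nstar := [set x : nstar | n <= x <= k].

Definition interval_family (K : set (set nstar)) : Prop :=
  K `<=` FINstar /\
  forall E, K E -> E !=set0 -> exists n k : nstar, n <= k /\ E = interval n k.

Definition char_fun (E : set nstar) : prod_topology (fun _ : nstar => bool) :=
  fun n => n \in E.

Definition compact_family (K : set (set nstar)) : Prop :=
  compact (char_fun @` K).

Definition is_schreier_max (L : omega1 -> nstar -> omega1) (a : omega1)
    (n k : nstar) : Prop :=
  [/\ n <= k, schreier L a (interval n k)
    & forall j : nstar, n <= j -> schreier L a (interval n j) -> j <= k].

(* s_a^L(n); for a fundamental system the maximum exists, by                  *)
(* schreier_funP, so that the default value is never used.                    *)
Definition schreier_fun (L : omega1 -> nstar -> omega1) (a : omega1)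
    (n : nstar) : nstar :=
  xget n [set k | is_schreier_max L a n k].

Section SchreierFunP.

Variable L : omega1 -> nstar -> omega1.
Hypothesis Lfund : fundamental_system L.

Let co (p m : nat) : set nstar := [set x : nstar | p <= x < m].

Let set_before_trans (B : nat -> set nstar) (d : nat) :
    (forall i, i < d -> B i !=set0) ->
    (forall i, i.+1 < d -> set_before (B i) (B i.+1)) ->
  forall i j, i < j < d -> set_before (B i) (B j).
Proof.
move=> B0 ltB i; elim=> [|j IHj] /andP[] //; rewrite ltnS leq_eqVlt.
case/orP=> [/eqP->|ij] jd; first exact: ltB.
have [z Bz] := B0 j (ltnW jd).
move=> x y Bx By; apply: (@ltn_trans z).
  by apply: (IHj _ x z) => //; rewrite ij ltnW.
exact: (ltB j).
Qed.

Let co_bounded (a : omega1) : Prop :=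
  forall p, exists k, forall m, schreier L a (co p m) -> m <= k.

Let co_short p m : co p m = set0 -> m <= p.+2.
Proof.
move=> E; rewrite leqNgt; apply/negP => pm.
suff: co p m (NStar (isT : 1 < p.+2)) by rewrite E.
by rewrite /co /= pm andbT leqW.
Qed.

Let co_boundedW a : co_bounded a ->
  exists c : nat -> nat, {homo c : p q / p <= q} /\
    forall p m, schreier L a (co p m) -> m <= c p.
Proof.
move=> /choice[f fP]; exists (fun p => \max_(q < p.+1) f q); split.
- move=> p q pq; apply/bigmax_leqP => -[i ip] _ /=.
  have iq : i < q.+1 by exact: leq_trans ip _.
  by apply: leq_trans (leq_bigmax (Ordinal iq)).
- move=> p m /fP; move/leq_trans; apply.
  exact: leq_trans (leq_bigmax (@ord_max p)).
Qed.

Let union_bound a (c : nat -> nat) : {homo c : p q / p <= q} ->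
    (forall p m, schreier L a (co p m) -> m <= c p) ->
  forall d (B : nat -> set nstar), 
    (forall i, i < d -> schreier L a (B i)) ->
    (forall i, i < d -> B i !=set0) ->
    (forall i, i.+1 < d -> set_before (B i) (B i.+1)) ->
  forall p m, co p m = \bigcup_(i < d) B i -> m <= iter d c p.+2.
Proof.
move=> cmono cP; elim=> [|d IHd] B SB B0 ltB p m coE.
  apply: co_short; rewrite coE; apply/seteqP; split=> // x [].
  by move=> i /=; rewrite ltn0.
have ltBt := set_before_trans B0 ltB.
have [z [Bz zmin]] : exists z : nstar, B d z /\ forall y, B d y -> z <= y.
  have [z0 Bz0] := B0 d (leqnn _).
  have ex : exists n, `[< exists2 z, B d z & n = nstar_val z >].
    by exists z0; apply/asboolP; exists z0.
  case: (ex_minnP ex) => n /asboolP[z Bz ->] nmin; exists z; split=> // y By.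
  by apply: nmin; apply/asboolP; exists y.
have Uz : (\bigcup_(i < d.+1) B i) z by exists d => /=.
have /andP[pz zm] : p <= z < m by move: Uz; rewrite -coE.
have BdE : B d = co z m.
  apply/seteqP; split=> x.
  - move=> Bx; rewrite /co /= zmin //=.
    have : (\bigcup_(i < d.+1) B i) x by exists d => /=.
    by rewrite -coE => /andP[].
  - move=> /andP[zx xm]; have : co p m x by rewrite /co /= xm (leq_trans pz).
    rewrite coE => -[i /=]; rewrite ltnS leq_eqVlt => /orP[/eqP-> //|id] Bx.
    by have := ltBt i d _ x z Bx Bz; rewrite id leqnn ltnNge zx => /(_ isT).
have UE : co p z = \bigcup_(i < d) B i.
  apply/seteqP; split=> x.
  - move=> /andP[px xz]; have : co p m x.
      by rewrite /co /= px (ltn_trans xz).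
    rewrite coE => -[i /=]; rewrite ltnS leq_eqVlt => /orP[/eqP->|id] Bx.
      by have := zmin x Bx; rewrite leqNgt xz.
    by exists i.
  - move=> [i /= id Bx]; have : (\bigcup_(i < d.+1) B i) x.
      by exists i => //=; exact: leqW.
    rewrite -coE => /andP[px _]; rewrite /co /= px /=.
    by apply: (ltBt i d) => //; rewrite id leqnn.
have zc : z <= iter d c p.+2.
  apply: (IHd B) UE => i id; [exact/SB/leqW | exact/B0/leqW |].
  by apply/ltB/leqW.
rewrite iterS; apply: leq_trans (cmono _ _ zc); apply: cP.
by rewrite -BdE; exact: SB.
Qed.

Let schreier_co_bounded a : co_bounded a.
Proof.
elim/omega1_ind: a => a IHa.
have [a0|nz] := pselect (is_zero a).
  move=> p; exists p.+3 => m; rewrite schreier_zeroE // => -[/co_short|].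
    by move=> mp; exact: leqW.
  move=> [n _ nE]; rewrite leqNgt; apply/negP => pm.
  have : co p m (NStar (isT : 1 < p.+2)).
    by rewrite /co /= (ltn_trans _ pm) ?andbT // leqW.
  have : co p m (NStar (isT : 1 < p.+3)).
    by rewrite /co /= pm andbT !leqW.
  by rewrite -nE /= => <- /(congr1 nstar_val) /= /eqP; rewrite eqn_leq ltnn andbF.
have [[b ba]|ns] := pselect (exists b, is_succ b a); last first.
  have lim : is_limit a by split=> // b ba; apply: ns; exists b.
  have [_ Llt _] := Lfund lim.
  move=> p.
  have /choice[f fP] : forall d : nstar, exists k, forall m,
    schreier L (L a d) (co p m) -> m <= k by move=> d; exact: IHa.
  exists (p.+2 + \max_(i < p.+3) if insub (val i) is Some d then f d else 0).
  move=> m; rewrite schreier_limitE // => -[/co_short mp|].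
    exact: leq_trans mp (leq_addr _ _).
  move=> [_ _ [d [dE /fP mf]]].
  have [mp|pm] := leqP m p.+2; first exact: leq_trans mp (leq_addr _ _).
  have dp : d < p.+3.
    rewrite ltnS; apply: (dE (NStar (isT : 1 < p.+2))).
    by rewrite /co /= pm andbT !leqW.
  apply: leq_trans mf _; apply: leq_trans (leq_addl _ _).
  have := leq_bigmax (F := fun i : 'I_p.+3 =>
    if insub (val i) is Some d then f d else 0) (Ordinal dp).
  by rewrite /= valK.
have [c [cmono cP]] := co_boundedW (IHa b ba.1).
move=> p; exists (p.+2 + \max_(i < p.+3) iter i c p.+2 + c p).
move=> m; rewrite (schreier_succE _ ba) => -[/cP mc|].
  exact: leq_trans mc (leq_addl _ _).
move=> [d [B [coE dB ltB SB]]].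
have [mp|pm] := leqP m p.+2.
  by rewrite -addnA; exact: leq_trans mp (leq_addr _ _).
have B0 i : i < d -> B i !=set0 by move=> /SB[_ /eqP/set0P].
have ltBt := set_before_trans B0 ltB.
have dp : d < p.+3.
  rewrite ltnS; set x := NStar (isT : 1 < p.+2).
  have : co p m x by rewrite /co /= pm andbT !leqW.
  rewrite coE => -[[|i] /= id Bx]; first exact: (dB x Bx).
  have [y By] := B0 0 (leq_ltn_trans (leq0n _) id).
  apply: leq_trans (dB y By) _; apply/ltnW.
  by apply: (ltBt 0 i.+1 _ y x) => //; rewrite id.
apply: leq_trans (leq_addr _ _); apply: leq_trans (leq_addl _ _).
apply: leq_trans (leq_bigmax (Ordinal dp)) => /=.
by apply: (union_bound cmono cP _ B0 ltB coE) => i /SB[].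
Qed.

Let schreier_single a n : schreier L a [set n].
Proof.
elim/omega1_ind: a => a IHa.
have [a0|nz] := pselect (is_zero a); first exact: schreier_zero_single.
have [[b ba]|ns] := pselect (exists b, is_succ b a).
  by apply: schreier_succ_incl (ba) _; apply: IHa; case: ba.
have lim : is_limit a by split=> // b ba; apply: ns; exists b.
have [_ Llt _] := Lfund lim.
apply: (schreier_limit_mem (d := NStar (isT : 1 < 2))) => //.
- exact: finite_set1.
- by exists n.
- by move=> x _; exact: nstar_valP.
- exact/IHa/Llt.
Qed.

Lemma schreier_funP a n : is_schreier_max L a n (schreier_fun L a n).
Proof.
rewrite /schreier_fun; case: xgetP => [k -> //|noK]; exfalso.
have [k kP] := @schreier_co_bounded a n.
pose P (j : nat) := `[< exists2 x : nstar, j = x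
  & n <= x /\ schreier L a (interval n x) >].
have exP : exists j, P j.
  exists (n : nat); apply/asboolP; exists n => //; split=> //.
  rewrite (_ : interval n n = [set n]); first exact: schreier_single.
  apply/seteqP; split=> x /=; rewrite /interval /=.
    by rewrite -eqn_leq => /eqP nx; apply/val_inj.
  by move=> ->; rewrite leqnn.
have ubP j : P j -> j <= k.
  move=> /asboolP[x -> [nx Sx]]; apply: ltnW; apply: kP.
  by rewrite (_ : co n x.+1 = interval n x).
case: (@ex_maxnP P k exP ubP) => j /asboolP[x -> [nx Sx]] jmax.
apply: (noK x); split=> // y ny Sy; apply: jmax; apply/asboolP; by exists y.
Qed.

End SchreierFunP.

Definition le_star (g h : nstar -> nstar) : Prop :=
  finite_set [set n | ~~ (g n <= h n)].

Definition star_unbounded (F : set (nstar -> nstar)) : Prop :=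
  ~ exists h, forall f, F f -> le_star f h.

(* The cardinality of [X] is the least cardinality of an unbounded family. *)
Definition is_bounding_number (T : Type) (X : set T) : Prop :=
  (exists F, star_unbounded F /\ F #= X) /\
  forall F, star_unbounded F -> X #<= F.

(* Main.v *)
Require Import Defs.
From mathcomp Require Import all_boot all_order.
From mathcomp Require Import boolp classical_sets functions cardinality topology.

(* A single system of fundamental sequences serves for (2), (3) and (4), and  *)
(* (2) is the pivot.  Whatever the system, s_(a+1)(n) > s_a(n), so that       *)
(* s_(a+k)(n) >= n + k; hence at a limit l the ordinals l[n] can be moved     *)
(* finitely many successor steps up, to make s_l dominate a prescribed        *)
(* function, for instance one bounding all f_b with b < l, where (f_b) is an  *)
(* unbounded family.  Conversely an unbounded family is uncountable, because  *)
(* countable families are bounded.                                            *)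
(* In a compact interval family only finitely many members start at a given   *)
(* n, so an infinite one contains some [p(N), q(N)] with p(N) >= N for each   *)
(* N, and s_a(N) > q(N) infinitely often for some a.  The converse uses the   *)
(* sequence [n, h(n) + 1], which converges to the empty set.                  *)
(* For a <= b, the members of S_a with large minimum belong to S_b, so (s_a)  *)
(* increases modulo finite sets and each uncountable subfamily is unbounded;  *)
(* this gives (4), and its converse is a pigeonhole argument on the stage     *)
(* from which s_a <= h.                                                       *)

Set Implicit Arguments.
Unset Strict Implicit.
Unset Printing Implicit Defensive.

Import Order.TTheory.

Local Open Scope classical_set_scope.

(** The implications run in the cycle (1), (2), (3), (4), (1), and the last two return to (2) before
    going on. Three facts carry them. Schreier families are hereditary ([schreier_subset]), so a
    value s_a(n) puts every subset of [n, s_a(n)] into S_a. They increase up to a condition on the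
    minimum ([schreier_tail]). Fundamental sequences can be chosen to make s_l large at limits
    ([fundamental_system_above]). With [countable_le_star_bounded], every unbounded family has at
    least omega_1 members. *)

(** * Finite sets and domination modulo finite sets *)

Lemma nstar_finiteP (A : set nstar) :
  finite_set A <-> exists m : nat, forall x : nstar, A x -> x <= m.
Proof.
split=> [/finite_seqP[s ->]|[m Am]].
  exists (\max_(x <- s) nstar_val x) => x /= xs.
  by rewrite (big_rem x) //= leq_maxl.
apply: (@sub_finite_set _ _ (nstar_val @^-1` `I_m.+1)).
  by move=> x /Am; rewrite /= ltnS.
by apply: finite_preimage; [move=> x y _ _; exact: val_inj | exact: finite_II].
Qed.

Lemma interval_finite (n k : nstar) : finite_set (interval n k).
Proof. by apply/nstar_finiteP; exists k => x /andP[]. Qed.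

Lemma card_le_surj (T U : Type) (A : set T) (B : set U) :
  (A #<= B)%card -> A !=set0 ->
  exists f : U -> T, set_fun B A f /\ set_surj B A f.
Proof.
move=> /pfcard_geP[-> [] //|[f] _]; exists f; split; [exact: funS | exact: surj].
Qed.

(** Diagonalisation: the bound at n exceeds the values at n of the first n members. The maximum with
    n only keeps it at least 2. *)
Lemma countable_le_star_bounded (F : set (nstar -> nstar)) : countable F ->
  exists h, forall f, F f -> le_star f h.
Proof.
move=> cF; have [F0|nF] := pselect (F !=set0); last first.
  by exists id => f Ff; case: nF; exists f.
have [u [_ uF]] := card_le_surj cF F0.
have h2 (n : nstar) : 2 <= maxn n (\max_(i < n) u i n).
  by rewrite leq_max nstar_valP.
exists (fun n => NStar (h2 n)) => f /uF[i _ <-].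
apply/nstar_finiteP; exists i => n; rewrite [n <= i]leqNgt; apply: contra => lt_in /=.
by rewrite leq_max (leq_bigmax (Ordinal lt_in)) orbT.
Qed.

(** * Successors, limits and cofinality in omega_1 *)

Lemma omega1_wf : well_founded (fun a b : omega1 => (a < b)%O).
Proof. by elim/omega1_ind => a IHa; constructor. Qed.

(* An injection is built by transfinite recursion: each new value avoids the  *)
(* countably many previous ones.                                              *)
Lemma omega1_card_le (T : Type) (X : set T) :
  ~ countable X -> ([set: omega1] #<= X)%card.
Proof.
move=> ncX.
have /choice[sel selP] (C : set T) : exists x, countable C -> X x /\ ~ C x.
  have [cC|ncC] := pselect (countable C); last first.
    have [[x _]|X0] := pselect (X !=set0); first by exists x.
    case: ncX; apply: sub_countable (subset_card_le _) (countable0 T) => x Xx.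
    by case: X0; exists x.
  apply: contrapT => nx; apply: ncX; apply: sub_countable (subset_card_le _) cC.
  move=> x Xx; apply: contrapT => nCx; by apply: nx; exists x.
pose step (a : omega1) (f : forall b, (b < a)%O -> T) :=
  sel [set x | exists b (ba : (b < a)%O), x = f b ba].
pose f := Fix omega1_wf (fun=> T) step.
have fE a : f a = sel [set f b | b in [set b | (b < a)%O]].
  rewrite /f Fix_eq => [|b g h gh].
    congr sel; apply/seteqP; split=> x [b].
      by move=> [ba ->]; exists b.
    by move=> ba <-; exists b, ba.
  congr (step _ _); apply: functional_extensionality_dep => c.
  by apply: functional_extensionality_dep => cb; exact: gh.
have fP a : X (f a) /\ ~ [set f b | b in [set b | (b < a)%O]] (f a).
  rewrite [f a]fE; apply: selP; apply: sub_countable (card_image_le _ _) _.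
  exact: omega1_countable_below.
have finj : injective f.
  by move=> a b fab; case: (ltgtP a b) => // [ab|ba];
    [case: (fP b) => _ []; exists a | case: (fP a) => _ []; exists b].
apply: card_le_trans (subset_card_le (_ : range f `<=` X)); last first.
  by move=> _ [a _ <-]; case: (fP a).
suff : (range f #= [set: omega1])%card by rewrite card_eq_le => /andP[].
by apply: inj_card_eq => a b _ _; exact: finj.
Qed.

Lemma uncountable_cofinal (A : set omega1) : ~ countable A ->
  forall b, exists2 a, A a & (b <= a)%O.
Proof.
move=> ncA b; apply: contrapT => nA; apply: ncA.
apply: sub_countable (subset_card_le _) (omega1_countable_below b) => a Aa /=.
by rewrite ltNge; apply/negP => ba; apply: nA; exists a.
Qed.

Lemma omega1_cases (a : omega1) :
  [\/ is_zero a, exists b, is_succ b a | is_limit a].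
Proof.
have [a0|nz] := pselect (is_zero a); first by constructor 1.
have [sa|ns] := pselect (exists b, is_succ b a); first by constructor 2.
by constructor 3; split=> // b ba; apply: ns; exists b.
Qed.

Definition succ1 (a : omega1) : omega1 := sval (cid (omega1_succ_ex a)).

Lemma succ1P a : is_succ a (succ1 a).
Proof. by rewrite /succ1; case: cid. Qed.

Lemma limit_succ1 l a : is_limit l -> (a < l)%O -> (succ1 a < l)%O.
Proof.
move=> [_ ns] al; rewrite lt_neqAle (succ1P a).2 // andbT.
by apply/eqP => al'; apply: (ns a); rewrite -al'; exact: succ1P.
Qed.

Lemma limit_iter_succ1 l k a : is_limit l ->
  (a < l)%O -> (iter k succ1 a < l)%O.
Proof. by move=> lim al; elim: k => //= k; exact: limit_succ1. Qed.

Lemma le_iter_succ1 k a : (a <= iter k succ1 a)%O.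
Proof.
elim: k => //= k /le_trans; apply; apply: ltW.
by case: (succ1P (iter k succ1 a)).
Qed.

(** The limit is the least strict upper bound of b, b+1, b+2, ...; one exists because countably many
    initial segments cannot cover omega_1. *)
Lemma limit_above (b : omega1) : exists2 l, is_limit l & (b < l)%O.
Proof.
have [u uub] : exists u, forall k, (iter k succ1 b < u)%O.
  apply: contrapT => nu; apply: omega1_uncountable.
  apply: (@sub_countable _ _ _
    (\bigcup_(k in [set: nat]) [set a | (a <= iter k succ1 b)%O])).
    apply: subset_card_le => a _; apply: contrapT => na; apply: nu.
    exists a => k.
    by rewrite ltNge; apply/negP => ak; apply: na; exists k.
  apply: bigcup_countable => // k _.
  apply: sub_countable (subset_card_le _)
    (omega1_countable_below (succ1 (iter k succ1 b))).
  move=> a /= /le_lt_trans; apply; exact: (succ1P _).1.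
have [|l lub lmin] := @omega1_min [set u | forall k, (iter k succ1 b < u)%O].
  by exists u.
exists l; last exact: (lub 0).
split=> [/(_ b)|a [al amin]]; first by rewrite leNgt (lub 0).
have : ~ (forall k, iter k succ1 b < a)%O.
  by move=> /lmin; rewrite leNgt al.
apply=> k; rewrite ltNge; apply/negP => ak.
have /amin : (a < iter k.+1 succ1 b)%O by apply: le_lt_trans ak (succ1P _).1.
by rewrite leNgt lub.
Qed.

(** * Structure of the Schreier families and of the functions s_a *)

Lemma schreier_finite L a E : schreier L a E -> finite_set E.
Proof.
elim=> {a E} [a _|a n _|a b E _ _ //|a b d B _ _ fB _ _ _|l _|//].
- exact: finite_set0.
- exact: finite_set1.
- by apply: bigcup_finite => //; exact: finite_II.
- exact: finite_set0.
Qed.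

(** Intersect each block with F and drop the empty traces. Blocks that were not adjacent may become
    neighbours, hence the order hypothesis on all pairs. *)
Lemma blocks_subset (S : set (set nstar)) d (B : nat -> set nstar) :
    (forall E F, S E -> F `<=` E -> S F) ->
    (forall i, i < d -> S (B i)) ->
    (forall i j, i < j < d -> set_before (B i) (B j)) ->
  forall F, F `<=` \bigcup_(i < d) B i ->
  exists e (C : nat -> set nstar), [/\ e <= d, F = \bigcup_(i < e) C i,
    forall i, i < e -> S (C i) /\ C i !=set0
    & forall i, i.+1 < e -> set_before (C i) (C i.+1)].
Proof.
move=> hS; elim: d => [|d IHd] SB ltB F FB.
  by exists 0, B; split=> //; apply/seteqP; split=> x; [move/FB|case].
have [i id|i j /andP[ij jd]|G|] := IHd _ _ (F `&` \bigcup_(i < d) B i).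
- exact/SB/leqW.
- by apply: ltB; rewrite ij leqW.
- by case.
move=> e [C [ed FC SC ltC]].
have FE : F = (F `&` \bigcup_(i < d) B i) `|` (F `&` B d).
  rewrite -setIUr; apply/seteqP; split=> x; last by case.
  move=> Fx; split=> //; have [i /=] := FB _ Fx.
  by rewrite ltnS leq_eqVlt => /orP[/eqP->|id] Bx; [right | left; exists i].
have [F0|F0] := pselect (F `&` B d !=set0); last first.
  exists e, C; split=> //; first exact: leqW.
  rewrite FE (_ : F `&` B d = set0) ?setU0 //.
  by apply/seteqP; split=> x // Fx; apply: F0; exists x.
exists e.+1, (fun i => if i < e then C i else F `&` B d); split=> //.
- rewrite [LHS]FE FC; apply/seteqP; split=> x.
  + case=> [[i /= ie Cx]|Fx]; first by exists i => /=; [exact: leqW | rewrite ie].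
    by exists e => /=; rewrite ?ltnn.
  + case=> i /= _; case: ifP => [ie|_] Cx; last by right.
    by left; exists i.
- move=> i _; case: ifP => [/SC //|_]; split=> //.
  by apply: (hS (B d)) => [|x []//]; exact: SB.
- move=> i; rewrite ltnS => ie; rewrite ie; case: ifP => [/ltC //|_] x y Cx [_ By].
  have : (F `&` \bigcup_(i < d) B i) x by rewrite FC; exists i.
  by case=> _ [j /= jd Bx]; apply: (ltB j d) => //; rewrite jd leqnn.
Qed.

(** Transitivity passes through a point of the middle block, as [set_before] is vacuous on empty
    sets. *)
Lemma set_before_lt (B : nat -> set nstar) d :
    (forall i, i < d -> B i !=set0) ->
    (forall i, i.+1 < d -> set_before (B i) (B i.+1)) ->
  forall i j, i < j < d -> set_before (B i) (B j).
Proof.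
move=> B0 ltB i; elim=> [|j IHj] /andP[] //; rewrite ltnS leq_eqVlt.
case/orP=> [/eqP->|ij] jd; first exact: ltB.
have [z Bz] := B0 j (ltnW jd).
move=> x y Bx By; apply: (@ltn_trans z); last exact: (ltB j).
by apply: (IHj _ x z) => //; rewrite ij ltnW.
Qed.

Lemma schreier_empty L a : fundamental_system L -> schreier L a set0.
Proof.
move=> Lfund; elim/omega1_ind: a => a IHa; case: (omega1_cases a).
- exact: schreier_zero_empty.
- by move=> [b ba]; apply: schreier_succ_incl (ba) (IHa _ ba.1).
- exact: schreier_limit_empty.
Qed.

Lemma schreier_subset L a E F : fundamental_system L ->
  schreier L a E -> F `<=` E -> schreier L a F.
Proof.
move=> Lfund; elim/omega1_ind: a => a IHa in E F *.
have [->|/eqP/set0P F0] := pselect (F = set0).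
  by move=> _ _; exact: schreier_empty.
case: (omega1_cases a) => [a0|[b ba]|lim].
- rewrite schreier_zeroE // => -[-> FE|[n _ <-] FE].
    by case: F0 => x /FE.
  right; exists n => //; apply/seteqP; split=> // x ->.
  by case: F0 => y Fy; rewrite -(FE y Fy).
- rewrite (schreier_succE _ ba) => -[SE FE|].
    by left; apply: (IHa b ba.1) SE FE.
  move=> [d [B [-> dB ltB SB]]] FB.
  have B0 i : i < d -> B i !=set0 by move=> /SB[_ /eqP/set0P].
  have ltBt := set_before_lt B0 ltB.
  have [|i /SB[]//|e [C [ed FC SC ltC]]] :=
    blocks_subset (S := schreier L b) _ _ ltBt FB.
    by move=> G H; apply: IHa; case: ba.
  have dF : le_set d F.
    move=> x /FB[[|i] /= id Bx]; first exact: dB.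
    have [y By] := B0 0 (leq_ltn_trans (leq0n _) id).
    apply: leq_trans (dB y By) _; apply: ltnW.
    by apply: (ltBt 0 i.+1) By Bx; rewrite id.
  (* The number e of surviving blocks replaces d, since e <= d <= min F. The union clause needs at
     least two blocks; a single one already lies in the lower family. *)
  have [e2|] := leqP 2 e.
    right; exists (NStar e2), C; split=> //.
      move=> x Cx /=; apply: leq_trans ed _; apply: dF.
      by rewrite FC; exists 0 => //=; exact: leq_trans e2.
    by move=> i /SC[? /set0P/eqP].
  case: e {ed ltC} FC SC => [|[|//]] FC SC _; first by case: F0 => x; rewrite FC => -[].
  left; rewrite FC (_ : \bigcup_(i < 1) C i = C 0); first by case: (SC 0).
  by apply/seteqP; split=> [x [[|i] //=]|x Cx]; exists 0.
- rewrite schreier_limitE // => -[-> FE|[fE _ [d [dE SE]]] FE].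
    by case: F0 => x /FE.
  right; split; [exact: sub_finite_set fE | exact/eqP/set0P |].
  exists d; split=> [x /FE/dE//|].
  by apply: (IHa _ _ E) => //; case: (Lfund _ lim).
Qed.

Lemma schreier_fun_ge L a (n k : nstar) : fundamental_system L ->
  n <= k -> schreier L a (interval n k) -> k <= schreier_fun L a n.
Proof. by move=> Lfund nk Sk; have [_ _] := schreier_funP Lfund a n; apply. Qed.

Lemma schreier_below_fun L a (n : nstar) E : fundamental_system L ->
  E `<=` interval n (schreier_fun L a n) -> schreier L a E.
Proof.
move=> Lfund; apply: schreier_subset => //.
by case: (schreier_funP Lfund a n).
Qed.

(** Induction on b. At a limit, some b[d] exceeds a, and the tail found for b[d] is cut further at d
    so that the limit clause applies with this d. *)
Lemma schreier_tail L a b : fundamental_system L -> (a <= b)%O ->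
  exists n : nstar, forall E, le_set n E -> schreier L a E -> schreier L b E.
Proof.
move=> Lfund; elim/omega1_ind: b => b IHb in a *.
rewrite le_eqVlt => /orP[/eqP->|ab].
  by exists (NStar (isT : 1 < 2)).
case: (omega1_cases b) => [/(_ a)|[c cb]|lim]; first by rewrite leNgt ab.
- have ac : (a <= c)%O by rewrite leNgt; apply/negP => /cb.2; rewrite leNgt ab.
  have [n nP] := IHb c cb.1 a ac; exists n => E nE SE.
  exact: schreier_succ_incl cb (nP _ nE SE).
- have [_ Llt [_ Lsup]] := Lfund _ lim.
  have [d ad] : exists d, (a < L b d)%O.
    apply: contrapT => nd; move: ab; rewrite ltNge => /negP; apply; apply: Lsup.
    by move=> _ [d _ <-]; rewrite leNgt; apply/negP => ad; apply: nd; exists d.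
  have [n nP] := IHb _ (Llt d) _ (ltW ad).
  have nd2 : 2 <= maxn n d by rewrite leq_max nstar_valP.
  exists (NStar nd2) => E ndE SE.
  have [->|/eqP/set0P E0] := pselect (E = set0); first exact: schreier_empty.
  apply: (schreier_limit_mem (d := d)) => //; first exact: schreier_finite SE.
    by move=> x /ndE /=; rewrite geq_max => /andP[].
  by apply: nP => // x /ndE /=; rewrite geq_max => /andP[].
Qed.

Lemma schreier_fun_le_star L a b : fundamental_system L -> (a <= b)%O ->
  le_star (schreier_fun L a) (schreier_fun L b).
Proof.
move=> Lfund ab; have [m mP] := schreier_tail Lfund ab.
apply/nstar_finiteP; exists m => n; apply: contraR; rewrite -ltnNge => mn.
have [nk Sk _] := schreier_funP Lfund a n.
apply: schreier_fun_ge => //; apply: mP Sk => x /andP[nx _].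
exact: leq_trans (ltnW mn) nx.
Qed.

(** With k = s_a(n), the set [n, k+1] is the union of the two blocks [n, k] and {k+1}; d = 2 is
    always admissible because all points are at least 2. *)
Lemma schreier_fun_succ L a b (n : nstar) : fundamental_system L ->
  is_succ a b -> schreier_fun L a n < schreier_fun L b n.
Proof.
move=> Lfund ab; have [nk Sk _] := schreier_funP Lfund a n.
set k := schreier_fun L a n in nk Sk *.
have k2 : 2 <= k.+1 by exact: leq_trans (nstar_valP k) _.
apply: (schreier_fun_ge (k := NStar k2)) => //=; first exact: leqW.
rewrite (schreier_succE _ ab); right.
exists (NStar (isT : 1 < 2)),
  (fun i => if i is 0 then interval n k else [set NStar k2]).
split=> //.
- apply/seteqP; split=> x.
    move=> /= /andP[nx]; rewrite leq_eqVlt ltnS => /orP[/eqP xk|xk].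
      by exists 1 => //; apply: val_inj.
    by exists 0 => //=; rewrite /interval /= nx.
  case=> -[_ /andP[nx xk]|i _ ->]; first by rewrite /interval /= nx leqW.
  by rewrite /interval /= leqnn leqW.
- by move=> x _; exact: nstar_valP.
- by case=> [_ x y /andP[_ xk] -> //|i]; rewrite !ltnS ltn0.
- case=> [|i] _; split=> //.
  + by apply/eqP/set0P; exists n; rewrite /interval /= leqnn.
  + have [kk _ _] := schreier_funP Lfund a (NStar k2).
    apply: (@schreier_below_fun _ _ (NStar k2)) => // x ->.
    by rewrite /interval /= leqnn.
  + by apply/eqP/set0P; exists (NStar k2).
Qed.

Lemma schreier_fun_iter_succ1 L a k (n : nstar) : fundamental_system L ->
  n + k <= schreier_fun L (iter k succ1 a) n.
Proof.
move=> Lfund; elim: k => [|k IHk].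
  by rewrite addn0; case: (schreier_funP Lfund a n).
rewrite addnS iterS; apply: leq_ltn_trans IHk _.
exact: schreier_fun_succ (succ1P _).
Qed.

(** * The bounding number and the functions s_a: (1) and (2) *)

(* Inserting finitely many successor steps below l[n] makes s_l(n) as large   *)
(* as wanted, whatever the system is below l.                                 *)
Lemma fundamental_system_above (g : omega1 -> nstar -> nstar) :
  exists L, fundamental_system L /\
    forall l n, is_limit l -> g l n <= schreier_fun L l n.
Proof.
have /choice[L LP] (l : omega1) : exists x : nstar -> omega1, is_limit l ->
    [/\ forall m n : nstar, m < n -> (x m < x n)%O, forall n, (x n < l)%O,
      supremums (range x) l & forall n, exists a, x n = iter (g l n) succ1 a].
  have [lim|nlim] := pselect (is_limit l); last by exists (fun=> l).
  have [b0 b0l] : exists b, (b < l)%O.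
    apply: contrapT => nb; apply: lim.1 => b.
    by rewrite leNgt; apply/negP => bl; apply: nb; exists b.
  have [|e [efun esurj]] := card_le_surj (omega1_countable_below l).
    by exists b0.
  have el k : (e k < l)%O by exact: efun.
  pose gn (k : nat) : nat := if insub k is Some n then g l n else 0.
  (* The maximum makes y increasing and, as e enumerates the ordinals below l, cofinal; the
     iteration adds the required successor steps. Only indices from 2 on enter the system, so the
     default in [gn] is harmless. *)
  pose y := fix y k := if k is k'.+1 then
    iter (gn k) succ1 (Order.max (succ1 (y k')) (e k')) else b0.
  have yl k : (y k < l)%O.
    elim: k => //= k yk; apply: limit_iter_succ1 => //.
    by rewrite gt_max el limit_succ1.
  have yS k : (y k < y k.+1)%O.
    apply: lt_le_trans (le_iter_succ1 _ _).
    by rewrite lt_max (succ1P (y k)).1.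
  have ye k : (e k <= y k.+1)%O.
    by apply: le_trans (le_iter_succ1 _ _); rewrite le_max lexx orbT.
  have ylt m n : m < n -> (y m < y n)%O.
    elim: n => // n IHn; rewrite ltnS leq_eqVlt => /orP[/eqP->//|/IHn ymn].
    exact: lt_trans ymn (yS n).
  exists (fun n : nstar => y n) => _; split=> [m n /ylt//|n//||[[//|n] n2]].
  - split=> [_ [n _ <-]|u uub]; first exact: ltW.
    rewrite leNgt; apply/negP => /esurj[k _ ku].
    (* Index k+2 always lies in [nstar], and it makes the inequality with e k strict. *)
    have : (y k.+2 <= u)%O by apply: uub; exists (NStar (isT : 1 < k.+2)).
    by rewrite -ku leNgt (le_lt_trans (ye k)).
  - by exists (Order.max (succ1 (y n)) (e n)); rewrite /= /gn insubT.
have Lfund : fundamental_system L by move=> l /LP[].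
exists L; split=> // l n lim; have [_ _ _ /(_ n)[a La]] := LP l lim.
have [nk Sk _] := schreier_funP Lfund (L l n) n.
(* The interval [n, s_{l[n]}(n)] has minimum n, so the limit clause with d = n puts it into S_l. *)
apply: (@leq_trans (schreier_fun L (L l n) n)).
  apply: leq_trans (leq_addl n _) _; rewrite La.
  exact: schreier_fun_iter_succ1.
apply: schreier_fun_ge => //; apply: (schreier_limit_mem (d := n)) => //.
- exact: interval_finite.
- by exists n; rewrite /interval /= leqnn.
- by move=> x /andP[].
Qed.

Lemma bounding_number_unbounded : is_bounding_number [set: omega1] ->
  exists L, fundamental_system L /\ star_unbounded (range (schreier_fun L)).
Proof.
move=> [[F [Fub]]]; rewrite card_eq_le => /andP[Fle _] _.
have F0 : F !=set0.
  by apply: contrapT => F0; apply: Fub; exists id => f Ff; case: F0; exists f.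
have [f [_ fF]] := card_le_surj Fle F0.
have /choice[g gP] (l : omega1) :
    exists h, forall b, (b < l)%O -> le_star (f b) h.
  have [|h hP] := @countable_le_star_bounded [set f b | b in [set b | (b < l)%O]].
    exact: sub_countable (card_image_le _ _) (omega1_countable_below l).
  by exists h => b bl; apply: hP; exists b.
have [L [Lfund LP]] := fundamental_system_above g.
exists L; split=> // -[h hP]; apply: Fub; exists h => _ /fF[b _ <-].
have [l lim bl] := limit_above b.
have : finite_set ([set n | ~~ (f b n <= g l n)] `|`
                   [set n | ~~ (schreier_fun L l n <= h n)]).
  by rewrite finite_setU; split; [exact: gP | apply: hP; exists l].
apply: sub_finite_set => n /= fh; have [fg|] := boolP (f b n <= g l n); last by left.
right; apply: contra fh => sh; apply: leq_trans fg _.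
exact: leq_trans (LP _ _ lim) sh.
Qed.

(** The family (s_a) is an image of omega_1, which gives the upper bound; the lower one holds
    because unbounded families are uncountable. *)
Lemma unbounded_bounding_number L : fundamental_system L ->
  star_unbounded (range (schreier_fun L)) -> is_bounding_number [set: omega1].
Proof.
move=> Lfund Lub.
have min F : star_unbounded F -> ([set: omega1] #<= F)%card.
  move=> Fub; apply: omega1_card_le => cF; apply: Fub.
  exact: countable_le_star_bounded.
split=> //; exists (range (schreier_fun L)); split=> //.
by rewrite card_eq_le card_image_le min.
Qed.

(** * Compact interval families: (2) and (3) *)

(** Otherwise intervals [n, k] in K with k tending to infinity would cluster at some finite E in K.
    But a point x >= n beyond max E lies in almost all of them and not in E. *)
Lemma compact_family_row_finite (K : set (set nstar)) (n : nstar) :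
  compact_family K -> K `<=` FINstar ->
  finite_set [set k : nstar | n <= k /\ K (interval n k)].
Proof.
move=> cK Kfin; apply: contrapT => infk.
have /choice[u uP] (j : nat) :
    exists k : nstar, [/\ j <= k, n <= k & K (interval n k)].
  apply: contrapT => nk; apply: infk; apply/nstar_finiteP; exists j => k [nk' Kk].
  by rewrite leqNgt; apply/negP => jk; apply: nk; exists k; rewrite ltnW.
pose v j := char_fun (interval n (u j)).
have [|_ [[E KE <-] vE]] := cK (v @ \oo) _.
  by exists 0 => // j _; exists (interval n (u j)) => //; case: (uP j).
have /nstar_finiteP[m Em] := Kfin _ KE.
have x2 : 2 <= maxn n m.+1 by rewrite leq_max nstar_valP.
pose x := NStar x2.
have nEx : x \notin E.
  by apply/negP => /set_mem/Em /=; rewrite leqNgt leq_max ltnS leqnn orbT.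
have Vx : nbhs (char_fun E) [set f : prod_topology (fun=> bool) | f x = false].
  apply: (@proj_continuous _ (fun _ : nstar => bool) x (char_fun E) [set false]).
  by apply/principal_filterP; exact/negbTE.
have vx : (v @ \oo) [set f | f x = true].
  exists x => // j /= xj; apply/mem_set; rewrite /interval /= leq_maxl /=.
  by apply: leq_trans xj _; case: (uP j).
by have [f [/= ->]] := vE _ _ vx Vx.
Qed.

(** A filter on this set that does not cluster at the limit contains a set of finitely many terms,
    and finite sets are compact. *)
Lemma cvg_seq_compact (T : topologicalType) (u : nat -> T) (x : T) :
  u @ \oo --> x -> compact (x |` range u).
Proof.
move=> ux F PF Fu; have [clx|nclx] := pselect (cluster F x).
  by exists x; split=> //; left.
have [A [B [FA Bx AB]]] : exists A B, [/\ F A, nbhs x B & A `&` B = set0].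
  apply: contrapT => nAB; apply: nclx => A B FA Bx.
  by apply/set0P/eqP => AB; apply: nAB; exists A, B.
have [N _ uB] := ux _ Bx.
have fin : finite_set [set u i | i in `I_N] by apply/finite_image/finite_II.
have [|y [[i _ <-] cly]] := finite_compact fin PF.
  apply: filterS (filterI FA Fu) => y [Ay]; case=> [yx|[i _ ui]].
    have : (A `&` B) x by split; [rewrite -yx | exact: nbhs_singleton].
    by rewrite AB.
  exists i => //=; rewrite ltnNge; apply/negP => Ni.
  have : (A `&` B) y by split=> //; rewrite -ui; exact: uB.
  by rewrite AB.
by exists (u i); split=> //; right; exists i.
Qed.

(** The intervals converge pointwise to the empty set: x is outside [n, h(n)] once n > x. *)
Lemma interval_sequence_compact (h : nstar -> nstar) :
  compact_family (set0 |` range (fun n => interval n (h n))).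
Proof.
pose I2 (j : nat) : nstar := NStar (isT : 1 < j.+2).
pose u j := char_fun (interval (I2 j) (h (I2 j))).
rewrite /compact_family (_ : _ @` _ = char_fun set0 |` range u).
  apply: cvg_seq_compact; apply/cvg_sup => x U [V] [[W] oW <-] Wx WU.
  exists x => // j /= xj; apply: WU => /=.
  suff -> : u j x = char_fun set0 x by [].
  rewrite /u /char_fun in_set0; apply/negbTE/negP => /set_mem /andP[/= jx _].
  by move: (leq_trans jx xj); rewrite ltnNge leqnSn.
rewrite image_setU image_set1; congr (_ `|` _); apply/seteqP; split=> f.
  move=> [_ [[[|[|j]] // n2] _ <-] <-]; exists j => //; rewrite /u.
  by rewrite (_ : I2 j = NStar n2) //; exact: val_inj.
by move=> [j _ <-]; exists (interval (I2 j) (h (I2 j))) => //; exists (I2 j).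
Qed.

Lemma unbounded_compact_family L : fundamental_system L ->
  star_unbounded (range (schreier_fun L)) ->
  forall K : set (set nstar),
    infinite_set K -> compact_family K -> interval_family K ->
    exists a : omega1, infinite_set (K `&` schreier L a).
Proof.
move=> Lfund Lub K infK cK [Kfin Kint].
have /choice[pq pqP] (N : nstar) : exists pq : nstar * nstar,
    [/\ N <= pq.1, pq.1 <= pq.2 & K (interval pq.1 pq.2)].
  (* Otherwise all non-empty members of K start at or below N, and each of these finitely many rows
     is finite. *)
  apply: contrapT => npq; apply: infK.
  apply: (@sub_finite_set _ _ (set0 |` \bigcup_(n in [set n : nstar | n <= N])
    [set interval n k | k in [set k : nstar | n <= k /\ K (interval n k)]])).
    move=> E KE; have [->|/eqP/set0P E0] := pselect (E = set0); first by left.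
    have [n [k [nk EE]]] := Kint E KE E0; rewrite EE in KE *.
    right; exists n => /=; last by exists k.
    by rewrite leqNgt; apply/negP => Nn; apply: npq; exists (n, k); rewrite ltnW.
  rewrite finite_setU; split; first exact: finite_set1.
  apply: bigcup_finite; first by apply/nstar_finiteP; exists N.
  by move=> n _; apply: finite_image; exact: compact_family_row_finite.
(* If every trace of K on an S_a is finite, then q dominates every s_a: where s_a(N) > q(N), the
   interval [p(N), q(N)] lies in that trace, and N <= p(N) is bounded by its union. *)
apply: contrapT => nK; apply: Lub; exists (fun N => (pq N).2) => _ [a _ <-].
have : finite_set (\bigcup_(E in K `&` schreier L a) E).
  apply: bigcup_finite => [|E [/Kfin//]].
  by apply: contrapT => inf; apply: nK; exists a.
move=> /nstar_finiteP[m mP]; apply/nstar_finiteP; exists m => N.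
rewrite /= -ltnNge => qs; have [Np pq' Kpq] := pqP N.
apply: leq_trans (Np) _; apply: mP; exists (interval (pq N).1 (pq N).2).
  split=> //; apply: (@schreier_below_fun _ _ N) => // x /andP[px xq].
  by rewrite /interval /= (leq_trans Np px) (leq_trans xq (ltnW qs)).
by rewrite /interval /= leqnn.
Qed.

Lemma compact_family_unbounded L : fundamental_system L ->
  (forall K : set (set nstar),
    infinite_set K -> compact_family K -> interval_family K ->
    exists a : omega1, infinite_set (K `&` schreier L a)) ->
  star_unbounded (range (schreier_fun L)).
Proof.
move=> Lfund LK [h hP].
(* The maximum with n keeps the interval non-empty; the successor forces s_a(n) > h(n) whenever
   [n, g(n)] is in S_a. *)
have g2 (n : nstar) : 2 <= (maxn n (h n)).+1.
  by rewrite ltnS (leq_trans _ (leq_maxl _ _)) // ltnW // nstar_valP.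
pose g n := NStar (g2 n).
have ng (n : nstar) : n <= g n by rewrite /= leqW // leq_maxl.
have gint (n : nstar) : interval n (g n) n by rewrite /interval /= leqnn ng.
have [|||a] := LK (set0 |` range (fun n => interval n (g n))).
- move=> fK.
  have : finite_set (\bigcup_(E in set0 |` range (fun n => interval n (g n))) E).
    apply: bigcup_finite => // E [->|[n _ <-]]; first exact: finite_set0.
    exact: interval_finite.
  move=> /nstar_finiteP[m mP].
  pose x := NStar (isT : 1 < m.+2).
  have /mP : (\bigcup_(E in set0 |` range (fun n => interval n (g n))) E) x.
    by exists (interval x (g x)) => //; right; exists x.
  by rewrite /= ltnNge leqnSn.
- exact: interval_sequence_compact.
- split=> [E [->|[n _ <-]]|E [->|[n _ <-]]].
  + exact: finite_set0.
  + exact: interval_finite.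
  + by case.
  + by exists n, (g n).
apply; apply: (@sub_finite_set _ _ (set0 |`
  [set interval n (g n) | n in [set n | ~~ (schreier_fun L a n <= h n)]])).
  move=> E [[->|[n _ <-]] SE]; first by left.
  right; exists n => //=; rewrite -ltnNge.
  by apply: leq_trans (schreier_fun_ge Lfund (ng n) SE); rewrite ltnS leq_maxr.
rewrite finite_setU; split; first exact: finite_set1.
by apply: finite_image; apply: hP; exists a.
Qed.

(** * Covers by uncountably many Schreier families: (2) and (4) *)

(** If n fails, a finite set E above n outside every S_a with a in A bounds all s_a(n) by max(2, max
    E). If all n fail, these bounds dominate s_a for a in A, hence for every a, as A is cofinal. *)
Lemma unbounded_uncountable_cover L : fundamental_system L ->
  star_unbounded (range (schreier_fun L)) ->
  forall A : set omega1, ~ countable A ->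
    exists n : nstar,
      [set E | FINstar E /\ E `<=` [set x : nstar | n <= x]] `<=`
        \bigcup_(a in A) schreier L a.
Proof.
move=> Lfund Lub A ncA; apply: contrapT => nn; apply: Lub.
have /choice[h hP] (n : nstar) :
    exists k : nstar, forall a, A a -> schreier_fun L a n <= k.
  apply: contrapT => nk; apply: nn; exists n => E [/nstar_finiteP[m Em] nE].
  apply: contrapT => nSE; apply: nk.
  have m2 : 2 <= maxn 2 m by rewrite leq_maxl.
  exists (NStar m2) => a Aa; rewrite leqNgt; apply/negP => ms; apply: nSE.
  exists a => //; apply: (@schreier_below_fun _ _ n) => // x Ex.
  rewrite /interval /= nE //=; apply: leq_trans (Em _ Ex) _.
  by apply: leq_trans (ltnW ms); rewrite /= leq_maxr.
exists h => _ [b _ <-]; have [a Aa ba] := uncountable_cofinal ncA b.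
apply: sub_finite_set (schreier_fun_le_star Lfund ba) => n /=.
by apply: contra => /leq_trans; apply; exact: hP.
Qed.

Lemma uncountable_cover_unbounded L : fundamental_system L ->
  (forall A : set omega1, ~ countable A ->
    exists n : nstar,
      [set E | FINstar E /\ E `<=` [set x : nstar | n <= x]] `<=`
        \bigcup_(a in A) schreier L a) ->
  star_unbounded (range (schreier_fun L)).
Proof.
move=> Lfund LA [h hP].
pose A m := [set a | forall n : nstar, m < n -> schreier_fun L a n <= h n].
have [m ncA] : exists m, ~ countable (A m).
  apply: contrapT => nm; apply: omega1_uncountable.
  apply: (@sub_countable _ _ _ (\bigcup_m A m)).
    apply: subset_card_le => a _.
    have /nstar_finiteP[m mP] : le_star (schreier_fun L a) h.
      by apply: hP; exists a.
    by exists m => // n mn; apply: contraLR mn => /mP; rewrite -leqNgt.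
  apply: bigcup_countable => // m _.
  by apply: contrapT => ncA; apply: nm; exists m.
have [n nP] := LA _ ncA.
(* Being at least n puts [p, q] under the cover; being above m makes s_a(p) <= h(p) for all a in
   [A m]. Then q > h(p) is contradictory. *)
have p2 : 2 <= maxn n m.+1 by rewrite leq_max nstar_valP.
pose p := NStar p2.
have q2 : 2 <= (maxn p (h p)).+1 by rewrite ltnS (leq_trans _ (leq_maxl _ _)) // ltnW.
have [|a Aa Sa] := nP (interval p (NStar q2)).
  split; first exact: interval_finite.
  by move=> x /andP[px _]; apply: leq_trans px; rewrite leq_maxl.
have sh : schreier_fun L a p <= h p by apply: Aa; rewrite /= leq_maxr.
have pq : p <= NStar q2 by rewrite /= leqW // leq_maxl.
by have := leq_trans (schreier_fun_ge Lfund pq Sa) sh; rewrite [nstar_val (NStar _)]/= ltnNge leq_maxr.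
Qed.

Theorem theorem1 :
  [<-> is_bounding_number [set: omega1];

       exists L, fundamental_system L /\
         star_unbounded (range (schreier_fun L));

       exists L, fundamental_system L /\
         forall K : set (set nstar),
           infinite_set K -> compact_family K -> interval_family K ->
           exists a : omega1, infinite_set (K `&` schreier L a);

       exists L, fundamental_system L /\
         forall A : set omega1, ~ countable A ->
           exists n : nstar,
             [set E | FINstar E /\ E `<=` [set x : nstar | n <= x]] `<=`
               \bigcup_(a in A) schreier L a].
Proof.
tfae.
- exact: bounding_number_unbounded.
- by move=> [L [Lfund Lub]]; exists L; split=> //; exact: unbounded_compact_family.
- move=> [L [Lfund LK]]; exists L; split=> //.
  by apply: unbounded_uncountable_cover => //; exact: compact_family_unbounded.
- move=> [L [Lfund LA]]; apply: unbounded_bounding_number (Lfund) _.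
  exact: uncountable_cover_unbounded.
Qed.
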